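(* Let $n$ be a non-negative integer, let $H_1$ and $H_2$ be two parallel open half-planes in $\mathbb{C}$ such that $\mathbb{C}\setminus(H_1\cup H_2)$ is a closed strip with non-empty interior, and let $T:\mathbb{C}_n[z]\to\mathbb{C}[z]$ be a linear operator. Then $T$ preserves $H_1\cup H_2$-stability, i.e. $T(\mathcal{P}_n(H_1\cup H_2))\subseteq\mathcal{P}(H_1\cup H_2)\cup\{0\}$, if and only if either (i) $T$ has range of dimension at most one and is of the form $T[f]=\alpha(f)p$ for $f\in\mathbb{C}_n[z]$, where $\alpha:\mathbb{C}_n[z]\to\mathbb{C}$ is a linear functional and $p\in\mathcal{P}(H_1\cup H_2)$; or (ii) $T$ satisfies both (a) and (b): (a) $T(\mathcal{P}_n(H_1))\subseteq\mathcal{P}(H_1)\cup\{0\}$ or $T(\mathcal{P}_n(H_2))\subseteq\mathcal{P}(H_1)\cup\{0\}$; (b) $T(\mathcal{P}_n(H_1))\subseteq\mathcal{P}(H_2)\cup\{0\}$ or $T(\mathcal{P}_n(H_2))\subseteq\mathcal{P}(H_2)\cup\{0\}$.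
   Context: $\mathbb{C}_n[z]$ is the space of complex polynomials of degree at most $n$. For $\Omega\subseteq\mathbb{C}$, a polynomial $p\in\mathbb{C}[z]$ is $\Omega$-stable if $p(z)\neq0$ for all $z\in\Omega$. $\mathcal{P}_n(\Omega)$ is the set of $\Omega$-stable polynomials in $\mathbb{C}_n[z]$, and $\mathcal{P}(\Omega)=\bigcup_{n\ge0}\mathcal{P}_n(\Omega)$. *)

(* Defs.v *)
From HB Require Import structures.
From mathcomp Require Import all_boot all_order all_algebra qpoly.
From mathcomp Require Import complex.
From mathcomp Require Import all_classical all_reals topology normedtype.

Set Implicit Arguments.
Unset Strict Implicit.
Unset Printing Implicit Defensive.

Import Order.TTheory GRing.Theory Num.Theory.
Import numFieldNormedType.Exports.
Local Open Scope classical_set_scope.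
Local Open Scope complex_scope.
Local Open Scope ring_scope.

Section Geometry.
Context {R : realType}.
Implicit Types (a z : R[i]) (c d : R) (H S : set R[i]).

(* Re (a^* * z) is the Euclidean inner product of a and z in the plane, so a is
   a normal vector of the boundary line. *)
Definition half_plane a c : set R[i] := [set z | c < complex.Re (a^* * z)].

Definition open_half_plane H :=
  exists a c, a != 0 /\ H = half_plane a c.

(* The boundary lines are parallel: their normal vectors are real multiples of
   each other, whatever the sides on which the half-planes lie. *)
Definition parallel_half_planes H1 H2 :=
  exists a c b d, [/\ a != 0, b != 0, exists t : R, b = t%:C * a,
    H1 = half_plane a c & H2 = half_plane b d].

Definition closed_strip S :=
  exists a c d, [/\ a != 0, c <= d &
    S = [set z | c <= complex.Re (a^* * z) <= d]].

(* The topology comes from the modulus: mathcomp-analysis attaches it to the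
   sort of a numFieldType, whence the cast. *)
Definition nonempty_interior S :=
  (S : set (R[i] : numFieldType))° !=set0.

End Geometry.

Section Stability.
Context {R : realType}.
Implicit Types (Om : set R[i]) (p : {poly R[i]}).

Definition stable Om p := forall z, Om z -> p.[z] != 0.

Definition stable_polyn (n : nat) Om : set {poly R[i]} :=
  [set p : {poly R[i]} | (size p <= n.+1)%N /\ stable Om p].

Definition stable_polys Om : set {poly R[i]} := \bigcup_n stable_polyn n Om.

(* size is degree plus one, so {poly_n.+1 R[i]} is the space of complex
   polynomials of degree at most n. *)
Definition maps_stable (n : nat) (T : {poly_n.+1 R[i]} -> {poly R[i]})
    (Om Om' : set R[i]) :=
  T @` [set f : {poly_n.+1 R[i]} | stable_polyn n Om f]
    `<=` stable_polys Om' `|` [set 0].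

Definition range_dim_le1 (n : nat) (T : {poly_n.+1 R[i]} -> {poly R[i]}) :=
  exists q, range T `<=` [set c *: q | c in [set: R[i]]].

End Stability.

(* Main.v *)
(**
  A linear functional [phi], evaluation of [T f] at a point [z0] of one of the two
  half-planes, is linear in each root of [f]. If [g] has one root less than allowed, then
  [phi (('X - x%:P) * g)] vanishes for exactly one [x]. When the roots of [g] lie in the strip,
  [x] does not, and since the strip is connected [x] stays on one side of it, say in [H1], when
  [g] varies. Then the roots of [g] can be moved one at a time through the complement of [H1]:
  the same connectedness argument keeps [x] in [H1]. So [phi] vanishes on no polynomial with
  all its roots outside [H1]. The side does not depend on [z0] in a given half-plane, again by
  connectedness. Every connectedness argument moves one real parameter polynomially, so the
  intermediate value theorem for polynomials suffices.

  This requires that [T] kills no polynomial with roots in the open strip, except in degrees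
  so low that [T] vanishes on all polynomials of at most that degree. If [T] kills a [g] with roots in
  the open strip but not all of the polynomials of degree at most [deg g], then a small
  perturbation of [g] times a factor with a root far away in the strip is killed too; climbing
  to degree [n], a killed polynomial all of whose perturbations are admissible forces [T] to
  have rank at most one. Polynomials with roots on the boundary lines follow from Hurwitz's
  theorem.
*)

Require Import Defs.
From HB Require Import structures.
From mathcomp Require Import all_boot all_order all_algebra qpoly.
From mathcomp Require Import complex.
From mathcomp Require Import all_classical all_reals topology normedtype.
From mathcomp Require Import ring lra.

Set Implicit Arguments.
Unset Strict Implicit.
Unset Printing Implicit Defensive.

Import Order.TTheory GRing.Theory Num.Theory.
Import numFieldNormedType.Exports.
Local Open Scope classical_set_scope.
Local Open Scope complex_scope.
Local Open Scope ring_scope.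

(** * Half-planes and strips *)

Section Height.
Context {R : rcfType}.
Implicit Types (a z w : R[i]) (c e t : R).

Definition height a z : R := complex.Re (a^* * z).

Lemma heightD a z w : height a (z + w) = height a z + height a w.
Proof. by rewrite /height mulrDr raddfD. Qed.

Lemma heightN a z : height a (- z) = - height a z.
Proof. by rewrite /height mulrN raddfN. Qed.

Lemma heightB a z w : height a (z - w) = height a z - height a w.
Proof. by rewrite heightD heightN. Qed.

Lemma heightNl a z : height (- a) z = - height a z.
Proof. by rewrite /height rmorphN mulNr raddfN. Qed.

Lemma heightZ a t z : height a (t%:C * z) = t * height a z.
Proof. by case: a z => [a1 a2] [z1 z2]; rewrite /height /=; ring. Qed.

Lemma heightZl a t z : height (t%:C * a) z = t * height a z.
Proof. by case: a z => [a1 a2] [z1 z2]; rewrite /height /=; ring. Qed.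

Lemma height_seg a (t : R) z w :
  height a (z + t%:C * (w - z)) = (1 - t) * height a z + t * height a w.
Proof. by rewrite heightD heightZ heightB; ring. Qed.

Lemma height_seg_lt a c t z w : height a z < c -> height a w < c ->
  0 <= t <= 1 -> height a (z + t%:C * (w - z)) < c.
Proof.
move=> hz hw /andP[t0 t1]; rewrite height_seg.
pose m := Num.max (height a z) (height a w).
have mc : m < c by rewrite gt_max hz hw.
apply: le_lt_trans mc; rewrite -[leRHS]mul1r -[X in X * m](subrK t 1) [leRHS]mulrDl.
by rewrite lerD // ler_wpM2l ?subr_ge0 // le_max lexx ?orbT.
Qed.

Lemma height_gt0 a : a != 0 -> 0 < height a a.
Proof.
case: a => [x y]; rewrite eq_complex /= negb_and /height /= => h.
have -> : x * x - - y * y = x ^+ 2 + y ^+ 2 by ring.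
by case/orP: h => h; [apply: ltr_pwDl | apply: ltr_wpDl];
  rewrite ?sqr_ge0 ?exprn_even_gt0.
Qed.

(** So ['i * a] is the direction along the strip: a translation by a real multiple of it changes no
    height. *)
Lemma height_rot a : height a ('i * a) = 0.
Proof. by case: a => [x y]; rewrite /height /=; ring. Qed.

Lemma height_le a z : `|height a z|%:C <= `|a| * `|z|.
Proof. by rewrite -[`|a|]normcJ -normrM normc_ge_Re. Qed.

Definition strip a e c : pred R[i] := fun z => e < height a z < c.

Lemma height_surj a c : a != 0 -> exists z, height a z = c.
Proof.
move=> /height_gt0 a0; exists ((c / height a a)%:C * a).
by rewrite heightZ divfK // gt_eqF.
Qed.

Lemma strip_nonempty a e c : a != 0 -> e < c -> exists w, strip a e c w.
Proof.
move=> a0 ec; have [w hw] := height_surj ((e + c) / 2) a0.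
by exists w; rewrite /strip hw; apply/andP; split; lra.
Qed.

Lemma strip_neg a e c z : strip (- a) (- c) (- e) z = strip a e c z.
Proof. by rewrite /strip heightNl !ltrN2 andbC. Qed.

Lemma height_div a (m : R) z w : w != 0 ->
  complex.Re (a^* * z * w^* - m%:C * w * w^*) = (height a (z / w) - m) * height w w.
Proof.
move=> w0; rewrite -[in LHS](divfK w0 z); move: (z / w) => {}z {w0}.
by case: a z w => [? ?] [? ?] [? ?]; rewrite /height /=; ring.
Qed.

Lemma Re_horner (p : {poly R[i]}) :
  exists q : {poly R}, forall t, q.[t] = complex.Re p.[t%:C].
Proof.
elim/poly_ind: p => [|p c [q hq]]; first by exists 0 => t; rewrite !horner0.
exists (q * 'X + (complex.Re c)%:P) => t; rewrite !hornerMXaddC hq.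
by case: p.[_] c => [x y] [u v] /=; ring.
Qed.

Lemma conj_horner (p : {poly R[i]}) t :
  (map_poly conjc p).[t%:C] = (p.[t%:C])^*.
Proof. by rewrite -[in LHS](conjc_real t) horner_map. Qed.

(* [|M|^2 (height a (L / M) - m)], with [m] in the middle of the strip, is a real
   polynomial in [t] without zeros on [[0, 1]]. *)
Lemma strip_ivt a e c (L M : {poly R[i]}) : e < c ->
  (forall t, 0 <= t <= 1 ->
     M.[t%:C] != 0 /\ ~~ strip a e c (L.[t%:C] / M.[t%:C])) ->
  c <= height a (L.[0] / M.[0]) -> c <= height a (L.[1] / M.[1]).
Proof.
move=> ec hLM h0.
pose m := (e + c) / 2.
have [Q hQ] := Re_horner (a^*%C *: L * map_poly conjc M - m%:C *: M * map_poly conjc M).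
have {hQ} hQ t : 0 <= t <= 1 -> exists2 N, 0 < N &
    Q.[t] = (height a (L.[t%:C] / M.[t%:C]) - m) * N.
  move=> /hLM [M0 _]; exists (height M.[t%:C] M.[t%:C]); first exact: height_gt0.
  rewrite hQ hornerD hornerN !hornerM !hornerZ conj_horner.
  exact: height_div.
have I0 : 0 <= (0 : R) <= 1 by rewrite lexx ler01.
have I1 : 0 <= (1 : R) <= 1 by rewrite lexx ler01.
have [N0 N0p Q0] := hQ _ I0; have [N1 N1p Q1] := hQ _ I1.
have [_] := hLM _ I1; rewrite /strip negb_and -!leNgt rmorph1 => /orP[] // he.
exfalso.
(* An end value at height at most [e] would take [Q] from nonnegative to nonpositive; a zero in
   between puts the quotient at height [m], inside the strip. *)
have [|t It /rootP Qt] := @poly_ivt _ (- Q) 0 1 ler01.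
  rewrite !hornerN Q0 Q1 rmorph0 rmorph1 oppr_le0 oppr_ge0.
  by rewrite pmulr_lge0 // pmulr_lle0 //; apply/andP; split; rewrite /m; lra.
have [N Np] := hQ _ It; move/eqP: Qt; rewrite hornerN oppr_eq0 => /eqP-> /esym/eqP.
rewrite mulf_eq0 (gt_eqF Np) orbF subr_eq0 => /eqP hm.
by have [_] := hLM _ It; rewrite /strip hm /m => /negP; apply; apply/andP; split; lra.
Qed.

End Height.

(** * Dependence of roots on coefficients *)

Section RootEstimates.
Context {R : rcfType}.
Notation C := R[i].
Implicit Types (a z w : C) (c e t : R) (p g h : {poly C}).

Definition roots_in (A : pred C) p := p != 0 /\ forall z, root p z -> A z.

Lemma roots_in_prod (A : pred C) p : roots_in A p ->
  exists u : seq C, [/\ all A u, size p = (size u).+1 &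
    p = lead_coef p *: \prod_(x <- u) ('X - x%:P)].
Proof.
case=> p0 hp; have [u Du] := closed_field_poly_normal p.
exists u; split=> //; last first.
  by rewrite {1}Du size_scale ?lead_coef_eq0 // size_prod_XsubC.
apply/allP=> x xu; apply: hp; rewrite Du rootZ ?lead_coef_eq0 //.
by rewrite root_prod_XsubC.
Qed.

Lemma prod_roots_in (A : pred C) (u : seq C) :
  all A u -> roots_in A (\prod_(x <- u) ('X - x%:P)).
Proof.
move=> /allP hu; split; first exact/monic_neq0/monic_prod_XsubC.
by move=> z; rewrite root_prod_XsubC => /hu.
Qed.

(** Multiply the bounds for the linear factors. The growth in [z] matches that of [horner_upper], so
    the two compare uniformly on an unbounded set. *)
Lemma roots_in_lower (A : pred C) p :
  (forall x, A x -> exists2 r : C, 0 < r &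
     forall z, ~~ A z -> r * (1 + `|z|) <= `|z - x|) ->
  roots_in A p -> exists2 r : C, 0 < r &
    forall z, ~~ A z -> r * (1 + `|z|) ^+ (size p).-1 <= `|p.[z]|.
Proof.
move=> hA hp; have [u [hu -> ->]] := roots_in_prod hp.
have: lead_coef p != 0 by rewrite lead_coef_eq0; case: hp.
move: (lead_coef p) => k k0 /=.
elim: u hu => [_|x u IHu /andP[Ax /IHu[r r0 hr]]].
  by exists `|k| => [|z _]; rewrite ?normr_gt0 // big_nil !hornerE.
have [s s0 hs] := hA x Ax; exists (s * r); first exact: mulr_gt0.
move=> z Az; rewrite big_cons exprS scalerAr hornerM hornerXsubC normrM.
by rewrite mulrACA ler_pM ?hr ?hs // ?mulr_ge0 ?exprn_ge0 ?addr_ge0 // ltW.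
Qed.

Lemma horner_upper p m : (size p <= m.+1)%N ->
  exists2 B : C, 0 < B & forall z, `|p.[z]| <= B * (1 + `|z|) ^+ m.
Proof.
move=> sp; exists (1 + \sum_(i < m.+1) `|p`_i|).
  by rewrite ltr_pwDl // sumr_ge0.
move=> z; rewrite (horner_coef_wide _ sp) (le_trans (ler_norm_sum _ _ _)) //.
rewrite mulrDl mul1r ler_wpDl ?exprn_ge0 ?addr_ge0 // mulr_suml ler_sum // => i _.
rewrite normrM normrX ler_wpM2l // (@le_trans _ _ ((1 + `|z|) ^+ i)) //.
  by rewrite lerXn2r ?nnegrE ?addr_ge0 // ler_wpDl.
by rewrite ler_weXn2l ?ler_wpDr // -ltnS.
Qed.

(** With [d] the gap in height from [z] to the nearer boundary line, [d <= |a| |w - z|]. Combined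
    with [1 + |w| <= (1 + |z|) + |w - z|], this gives the constant. *)
Lemma strip_dist a e c z : strip a e c z ->
  exists2 r : C, 0 < r & forall w, ~~ strip a e c w -> r * (1 + `|w|) <= `|w - z|.
Proof.
move=> /andP[ez zc]; pose d := Num.min (height a z - e) (c - height a z).
have d0 : 0 < d%:C :> C by rewrite ltcR lt_min !subr_gt0 ez zc.
have D0 : 0 < `|a| * (1 + `|z|) + d%:C.
  by rewrite ltr_wpDl // mulr_ge0 // addr_ge0.
exists (d%:C / (`|a| * (1 + `|z|) + d%:C)); first exact: divr_gt0.
move=> w hw; rewrite mulrAC ler_pdivrMr //.
have hd : d%:C <= `|a| * `|w - z|.
  apply: le_trans (height_le _ _); rewrite lecR heightB.
  move: hw; rewrite /strip negb_and -!leNgt ge_min => /orP[] h; apply/orP.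
    by left; rewrite ler_normr; apply/orP; right; lra.
  by right; rewrite ler_normr; apply/orP; left; lra.
have hw1 : 1 + `|w| <= (1 + `|z|) + `|w - z|.
  by rewrite -addrA lerD2l -{1}(subrK z w) addrC ler_normD.
rewrite (le_trans (ler_wpM2l (ltW d0) hw1)) // mulrDr [leRHS]mulrDr.
rewrite [`|w - z| * d%:C]mulrC lerD2r mulrA [`|w - z| * _]mulrC.
by rewrite ler_wpM2r // addr_ge0.
Qed.

(** Outside the strip [|k h|] stays below [|g|], as in Rouché's theorem, so no zero appears
    there. *)
Lemma roots_in_strip_perturb a e c g h :
  roots_in (strip a e c) g -> (size h <= size g)%N ->
  exists2 d : C, 0 < d & forall k, `|k| < d ->
    size (g + k *: h) = size g /\ roots_in (strip a e c) (g + k *: h).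
Proof.
move=> hg hs; have [g0 _] := hg.
have sg : (size g).-1.+1 = size g by rewrite prednK // lt0n size_poly_eq0.
have [r r0 hr] := roots_in_lower (@strip_dist a e c) hg.
have [B B0 hB] : exists2 B : C, 0 < B &
    forall z, `|h.[z]| <= B * (1 + `|z|) ^+ (size g).-1.
  by apply: horner_upper; rewrite sg.
have l0 : 0 < `|lead_coef g| by rewrite normr_gt0 lead_coef_eq0.
(* [b] keeps [k *: h] smaller than [g] outside the strip; [b'] keeps the leading coefficient from
   cancelling. *)
pose b := B / r; pose b' := (`|h`_(size g).-1| + 1) / `|lead_coef g|.
have b0 : 0 < b by rewrite divr_gt0.
have b'0 : 0 < b' by rewrite divr_gt0 // ltr_wpDl.
exists (b + b')^-1 => [|k]; first by rewrite invr_gt0 addr_gt0.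
rewrite -[X in _ < X]mul1r ltr_pdivlMr ?addr_gt0 // => hk.
have hk1 : `|k| * B < r.
  rewrite -[r]mul1r -ltr_pdivrMr // -mulrA; apply: le_lt_trans hk.
  by rewrite ler_wpM2l // lerDl ltW.
have hk2 : `|k * h`_(size g).-1| < `|lead_coef g|.
  rewrite -[X in _ < X]mul1r -ltr_pdivrMr // normrM -mulrA; apply: le_lt_trans hk.
  rewrite ler_wpM2l // (@le_trans _ _ b') ?lerDr ?(ltW b0) // /b'.
  by rewrite ler_pM2r ?invr_gt0 // lerDl.
have hc : (g + k *: h)`_(size g).-1 != 0.
  rewrite coefD coefZ; apply: contraTneq hk2 => /eqP; rewrite addr_eq0 => /eqP E.
  by rewrite -[k * _]opprK -E normrN ltxx.
have hsz : size (g + k *: h) = size g.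
  apply/eqP; rewrite eqn_leq (leq_trans (size_polyD _ _)) /=; last first.
    by rewrite geq_max leqnn (leq_trans (size_scale_leq _ _)).
  by rewrite -sg ltnNge; apply: contraNN hc => /leq_sizeP ->.
split=> //; split; first by rewrite -size_poly_eq0 hsz size_poly_eq0.
move=> z /rootP; rewrite hornerD hornerZ => /eqP; rewrite addr_eq0 => /eqP hz.
apply/negPn/negP => /hr; rewrite hz normrN normrM; apply/negP.
rewrite -real_ltNge ?realM ?ger0_real // ?exprn_ge0 ?addr_ge0 // ?ltW //.
rewrite (@le_lt_trans _ _ (`|k| * (B * (1 + `|z|) ^+ (size g).-1))) //.
  by rewrite ler_wpM2l.
by rewrite mulrA ltr_pM2r // exprn_gt0 // ltr_pwDl.
Qed.

(* If the roots have modulus at least [d], the elementary symmetric functions of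
   their inverses bound the coefficients in terms of the constant one. *)
Lemma coef_prod_XsubC_le (u : seq C) (d : C) m :
  0 < d -> all (fun x => d <= `|x|) u ->
  `|(\prod_(x <- u) ('X - x%:P))`_m| * d ^+ m
    <= 2 ^+ size u * `|(\prod_(x <- u) ('X - x%:P))`_0|.
Proof.
move=> d0; elim: u m => [|x u IHu] m.
  by rewrite big_nil !coef1; case: m => [|m]; rewrite ?normr0 ?mul0r ?mulr1 ?mul1r.
move=> /= /andP[dx /IHu{}IHu]; rewrite big_cons.
set p := \prod_(x <- u) _ in IHu *.
rewrite !mulrBl !coefB !coefXM !coefCM /= sub0r normrN normrM.
have x0 : 0 <= `|x| by [].
case: m => [|m].
  rewrite sub0r normrN normrM expr0 mulr1 ler_peMl ?mulr_ge0 //.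
  by rewrite exprn_ege1 // ler1n.
have -> : 2 ^+ (size u).+1 * (`|x| * `|p`_0|)
    = `|x| * (2 ^+ size u * `|p`_0|) + `|x| * (2 ^+ size u * `|p`_0|).
  by rewrite exprS; ring.
rewrite /= (le_trans (ler_wpM2r (exprn_ge0 _ (ltW d0)) (ler_normB _ _))) //.
rewrite mulrDl normrM -mulrA lerD ?ler_wpM2l //.
rewrite exprS mulrCA ler_pM ?mulr_ge0 ?exprn_ge0 // ltW //.
Qed.

End RootEstimates.

(** * Hurwitz's theorem for pencils of polynomials *)

Section Pencil.
Context {R : rcfType}.
Notation C := R[i].
Implicit Types (a z w : C) (c e t : R) (p A B : {poly C}).

(** Translating [z] to the origin gives a polynomial whose roots have modulus at least [d], so
    [coef_prod_XsubC_le] bounds the Taylor coefficients at [z] by the value there. *)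
Lemma coef_le_of_disc p z (d : C) m N : 0 < d -> (size p <= N)%N ->
  (forall w, `|w - z| < d -> p.[w] != 0) ->
  `|(p \Po ('X + z%:P))`_m| * d ^+ m <= 2 ^+ N * `|p.[z]|.
Proof.
move=> d0 sp hp; set q := p \Po _.
have p0 : p.[z] != 0 by apply: hp; rewrite subrr normr0.
have q0 : q != 0.
  apply: contraNneq p0 => /(congr1 (fun r : {poly C} => r.[0])).
  by rewrite horner_comp !hornerE => ->.
have hq : roots_in (fun x => d <= `|x|) q.
  split=> // x /rootP; rewrite horner_comp !hornerE => hx.
  rewrite real_leNgt ?ger0_real ?(ltW d0) //; apply/negP => xd.
  by have := hp (x + z); rewrite addrK hx eqxx => /(_ xd).
have -> : p.[z] = q`_0 by rewrite -horner_coef0 horner_comp !hornerE.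
have [u [hu su ->]] := roots_in_prod hq; rewrite !coefZ !normrM -mulrA.
rewrite [leRHS]mulrCA ler_wpM2l // (le_trans (coef_prod_XsubC_le m d0 hu)) //.
rewrite ler_wpM2r // ler_weXn2l ?ler1n //.
apply: leq_trans sp; apply: leq_trans (_ : size q <= _)%N; first by rewrite su.
by rewrite size_comp_poly2 // size_XaddC.
Qed.

Lemma small_eq0 (x k : C) : 0 <= x -> 0 <= k ->
  (forall t, 0 < t <= 1 -> x <= t%:C * k) -> x = 0.
Proof.
move=> x0 k0; move: (x0) (k0).
rewrite -(RRe_real (ger0_real x0)) -(RRe_real (ger0_real k0)) !lecR.
move: (complex.Re x) (complex.Re k) => {x0 k0}x {}k x0 k0 h; congr _%:C.
apply/eqP; rewrite eq_le x0 andbT leNgt; apply/negP => {}x0.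
have xk : 0 < x + k by lra.
(* At this [t] the bound reads [x <= x * k / (x + k)], which is impossible for positive [x]. *)
have := h (x / (x + k)); rewrite -rmorphM lecR => /(_ _)/wrap[].
  by rewrite divr_gt0 // ler_pdivrMr // mul1r lerDl.
rewrite mulrAC ler_pdivlMr // ler_pM2l // => H; lra.
Qed.

(* Hurwitz's theorem for the pencil [A + t B] as [t] tends to [0]. *)
Lemma pencil_stable a c A B :
  (forall t, 0 < t <= 1 -> A + t%:C *: B = 0 \/
     forall z, c < height a z -> (A + t%:C *: B).[z] != 0) ->
  A = 0 \/ forall z, c < height a z -> A.[z] != 0.
Proof.
move=> hAB; case: (pselect (exists2 z, c < height a z & A.[z] = 0)); last first.
  by move=> h; right=> z hz; apply/eqP => Az; apply: h; exists z.
case=> z hz Az; left.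
(* The disc of radius [d] about [z] stays in the half-plane. *)
have d0 : 0 < (height a z - c)%:C / (`|a| + 1) :> C.
  by rewrite divr_gt0 ?ltr_wpDl // ltcR subr_gt0.
set d := _ / _ in d0.
have hd w : `|w - z| < d -> c < height a w.
  rewrite ltr_pdivlMr ?ltr_wpDl // => h.
  have : `|height a (w - z)|%:C < (height a z - c)%:C.
    apply: le_lt_trans (height_le _ _) (le_lt_trans _ h).
    by rewrite mulrC ler_wpM2l // lerDl.
  by rewrite ltcR heightB ltr_norml => /andP[]; lra.
pose N := maxn (size A) (size B).
have key m t : 0 < t <= 1 ->
    `|((A + t%:C *: B) \Po ('X + z%:P))`_m| * d ^+ m
      <= 2 ^+ N * `|(A + t%:C *: B).[z]|.
  move=> /hAB[->|h].
    by rewrite comp_poly0 coef0 horner0 normr0 mul0r mulr0.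
  apply: coef_le_of_disc => [//||w /hd]; last exact: h.
  rewrite (leq_trans (size_polyD _ _)) // geq_max leq_maxl /=.
  by rewrite (leq_trans (size_scale_leq _ _)) // leq_maxr.
(* As [A] vanishes at [z], the pencil takes the value [t B(z)] there; by [key] every Taylor
   coefficient of [A] at [z] is then O(t), hence zero. *)
suff A0 : A \Po ('X + z%:P) = 0.
  apply/eqP; rewrite -size_poly_eq0 -(@size_comp_poly2 _ A ('X + z%:P)) ?A0 ?size_poly0 //.
  by rewrite size_XaddC.
apply/polyP => m; rewrite coef0; apply/eqP.
have dm : 0 < d ^+ m by rewrite exprn_gt0.
rewrite -normr_eq0 -(mulIr_eq0 _ (mulIf (lt0r_neq0 dm))); apply/eqP.
apply: (@small_eq0 _ (2 ^+ N * `|B.[z]| + `|(B \Po ('X + z%:P))`_m| * d ^+ m)).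
- by rewrite mulr_ge0 // ltW.
- by rewrite addr_ge0 ?mulr_ge0 ?exprn_ge0 // ltW.
move=> t ht; have := key m t ht; have /andP[t0 _] := ht.
have tn : `|t%:C| = t%:C :> C by rewrite ger0_norm // lecR ltW.
rewrite hornerD Az add0r hornerZ normrM tn comp_polyD comp_polyZ coefD coefZ.
set x := (_ \Po _)`_m; set y := (_ \Po _)`_m => h.
have : `|x| <= `|x + t%:C * y| + t%:C * `|y|.
  by rewrite -{1}(addrK (t%:C * y) x) (le_trans (ler_normB _ _)) // normrM tn.
move=> /(ler_wpM2r (ltW dm))/le_trans; apply.
by rewrite mulrDl mulrDr mulrCA -mulrA lerD.
Qed.

End Pencil.

(** * Functionals without zeros on strip polynomials *)

Section Functional.
Context {R : rcfType}.
Notation C := R[i].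
Variables (a w : C) (c e : R) (K n : nat) (phi : {scalar {poly C}}).
Implicit Types (x y z : C) (t : R) (g h : {poly C}) (s u : seq C).

Hypothesis a0 : a != 0.
Hypothesis ec : e < c.
Hypothesis phi_low : forall h, (size h <= K)%N -> phi h = 0.
Hypothesis phi_strip : forall g, roots_in (strip a e c) g ->
  (K < size g <= n.+1)%N -> phi g != 0.

(* [phi (('X - x%:P) * g)] vanishes exactly at [x = last_root g]. *)
Definition last_root g := phi ('X * g) / phi g.

Lemma phiZ x g : phi (x *: g) = x * phi g.
Proof. exact: linearZ. Qed.

Lemma phi_XsubC x g : phi (('X - x%:P) * g) = phi ('X * g) - x * phi g.
Proof. by rewrite mulrBl mul_polyC linearB /= phiZ. Qed.

Lemma phi_XsubC_root x g : phi g != 0 ->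
  phi (('X - x%:P) * g) = phi g * (last_root g - x).
Proof. move=> g0.
by rewrite phi_XsubC mulrBr [_ * last_root g]mulrC divfK // [phi g * x]mulrC. Qed.

Lemma roots_in_XsubC (A : pred C) x g :
  A x -> roots_in A g -> roots_in A (('X - x%:P) * g).
Proof.
move=> Ax [g0 hg]; split; first by rewrite mulf_neq0 // polyXsubC_eq0.
by move=> z; rewrite rootM root_XsubC => /orP[/eqP->|/hg].
Qed.

Lemma roots_in_exp (A : pred C) x j : A x -> roots_in A (('X - x%:P) ^+ j).
Proof.
move=> Ax; elim: j => [|j IHj]; last by rewrite exprS; apply: roots_in_XsubC.
by rewrite expr0; split=> [|z]; rewrite ?oner_neq0 ?(negPf (root1 _)).
Qed.

Lemma size_XsubCM x g : g != 0 -> size (('X - x%:P) * g) = (size g).+1.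
Proof. by move=> g0; rewrite size_monicM ?monicXsubC // size_XsubC. Qed.

(** Otherwise [phi] would kill a strip polynomial, [g] times its last factor; [size g <= n] leaves
    room for that factor. *)
Lemma last_root_strip g : roots_in (strip a e c) g -> (K < size g <= n)%N ->
  phi g != 0 /\ ~~ strip a e c (last_root g).
Proof.
move=> hg /andP[Kg gn]; have g0 : phi g != 0 by rewrite phi_strip // Kg leqW.
split=> //; apply/negP => ht.
have := phi_strip (roots_in_XsubC ht hg); rewrite phi_XsubC_root // subrr mulr0 eqxx.
by rewrite size_XsubCM ?ltnS ?gn ?(ltnW Kg) => [/(_ isT)|]; [|case: hg].
Qed.

(** One root moves from [y] to [x] along a segment, and [strip_ivt] applies: [L 'X] and [L 1] below
    are the numerator and denominator of [last_root], affine in the parameter. *)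
Lemma last_root_slide x y g :
  (forall t, 0 <= t <= 1 -> let z := y + t%:C * (x - y) in
     phi (('X - z%:P) * g) != 0 /\ ~~ strip a e c (last_root (('X - z%:P) * g))) ->
  c <= height a (last_root (('X - y%:P) * g)) ->
  c <= height a (last_root (('X - x%:P) * g)).
Proof.
pose L h := (phi (h * ('X - y%:P) * g))%:P - ((x - y) * phi (h * g))%:P * 'X : {poly C}.
have LE h k : (L h).[k] = phi (h * (('X - (y + k * (x - y))%:P) * g)).
  have -> : h * (('X - (y + k * (x - y))%:P) * g)
      = h * ('X - y%:P) * g - (k * (x - y)) *: (h * g) by rewrite -mul_polyC; ring.
  by rewrite /L hornerD hornerN !hornerM !hornerC hornerX linearB /= phiZ; ring.
move=> hz; have := @strip_ivt _ a e c (L 'X) (L 1) ec.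
rewrite !LE mul0r addr0 mul1r !mul1r [y + _]addrC subrK => H; apply: H => t.
by rewrite !LE !mul1r; exact: hz.
Qed.

Lemma strip_seg x y t : strip a e c x -> strip a e c y -> 0 <= t <= 1 ->
  strip a e c (y + t%:C * (x - y)).
Proof.
move=> /andP[ex xc] /andP[ey yc] ht; rewrite /strip height_seg_lt // andbT.
by rewrite -ltrN2 -heightNl height_seg_lt // heightNl ltrN2.
Qed.

(** The new root comes in from infinity along the strip, so that the degree can grow by one without
    changing sides. *)
Lemma last_root_grow x g : strip a e c x -> roots_in (strip a e c) g ->
  (K < size g < n)%N -> c <= height a (last_root g) ->
  c <= height a (last_root (('X - x%:P) * g)).
Proof.
move=> hx hg /andP[Kg gn]; have [g0 _] := hg.
have ia0 : 'i%C * a != 0.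
  by rewrite mulf_neq0 // eq_complex /= oner_eq0 andbF.
(* [M 1] is ['X - x%:P], [M 0] is a nonzero constant, and for other [t] the root of [M t] is
   [x + (1/t - 1) i a], at the height of [x]. *)
pose M t := t%:C *: ('X - (x - 'i%C * a)%:P) - ('i%C * a)%:P : {poly C}.
pose L h := (- ('i%C * a) * phi (h * g))%:P
  + (phi (h * (('X - (x - 'i%C * a)%:P) * g)))%:P * 'X : {poly C}.
have LE h t : (L h).[t%:C] = phi (h * (M t * g)).
  have -> : h * (M t * g) = t%:C *: (h * (('X - (x - 'i%C * a)%:P) * g))
      - ('i%C * a) *: (h * g) by rewrite /M -!mul_polyC; ring.
  by rewrite /L hornerD !hornerM !hornerC hornerX linearB /= !phiZ; ring.
have M1 : M 1 = 'X - x%:P by rewrite /M rmorph1 scale1r polyCB; ring.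
have M0 : M 0 * g = - ('i%C * a) *: g.
  by rewrite /M rmorph0 scale0r sub0r mulNr mul_polyC scaleNr.
have MN t : t != 0 -> M t = t%:C *: ('X - (x + (t^-1 - 1)%:C * ('i%C * a))%:P).
  move=> t0; have t0' : t%:C != 0 :> C by rewrite eq_complex /= negb_and t0.
  rewrite /M !scalerBr -addrA -opprD; congr (_ - _).
  rewrite -!mul_polyC -!polyCM -polyCD; congr _%:P.
  rewrite rmorphB rmorph1 fmorphV; field; exact: t0'.
move=> hc; have := @strip_ivt _ a e c (L 'X) (L 1) ec.
have LE0 h : (L h).[0] = phi (h * (M 0 * g)) := LE h 0.
have LE1 h : (L h).[1] = phi (h * (M 1 * g)) := LE h 1.
rewrite !LE0 !LE1 !mul1r M1 M0 => H; apply: H => [t ht|]; last first.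
  by rewrite -scalerAr !phiZ -mulf_div divff ?mul1r // oppr_eq0.
rewrite !LE !mul1r; have [->|t0] := eqVneq t 0.
  rewrite M0 -scalerAr !phiZ -mulf_div divff ?mul1r ?oppr_eq0 //.
  have [|p0 hp] := last_root_strip hg; first by rewrite Kg ltnW.
  by split=> //; rewrite mulf_neq0 ?oppr_eq0.
rewrite (MN _ t0) -scalerAl -scalerAr !phiZ -mulf_div.
have t0' : t%:C != 0 :> C by rewrite eq_complex /= negb_and t0.
rewrite divff // mul1r.
have [||p0 hp] := @last_root_strip (('X - (x + (t^-1 - 1)%:C * ('i%C * a))%:P) * g).
- by apply: roots_in_XsubC => //; rewrite /strip heightD heightZ height_rot mulr0 addr0.
- by rewrite size_XsubCM // gn ltnW.
by split=> //; rewrite mulf_neq0.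
Qed.

Hypothesis hw : strip a e c w.
Hypothesis Kn : (K < n)%N.
(** One of the two sides of the strip; the other reduces to it by changing the sign of [a]. *)
Hypothesis start : c <= height a (last_root (('X - w%:P) ^+ K)).

(** First the powers of ['X - w%:P] grow from degree [K]; then the roots slide one by one from [w]
    to their places in [s]. The exponent [i] counts those still at [w]. *)
Lemma last_root_base s i : all (strip a e c) s -> (K <= size s + i < n)%N ->
  c <= height a (last_root (\prod_(x <- s) ('X - x%:P) * ('X - w%:P) ^+ i)).
Proof.
have sX j : size (('X - w%:P) ^+ j) = j.+1 by rewrite size_exp_XsubC.
elim: s i => [|x s IHs] i /=.
  rewrite add0n big_nil mul1r => _ /andP[Ki iN].
  elim: i Ki iN => [|i IHi]; first by rewrite leqn0 => /eqP K0 _; move: start; rewrite K0.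
  rewrite leq_eqVlt => /orP[/eqP EK _|Ki iN]; first by rewrite -EK.
  rewrite exprS.
  apply: last_root_grow => //; first exact: roots_in_exp.
    by rewrite sX Ki.
  by apply: IHi => //; apply: ltnW.
move=> /andP[hx hs] Ki; rewrite big_cons -mulrA.
have hg : roots_in (strip a e c) (\prod_(x <- s) ('X - x%:P) * ('X - w%:P) ^+ i).
  elim: s hs {IHs Ki} => [|y s IHs] /=; first by rewrite big_nil mul1r => _; apply: roots_in_exp.
  by move=> /andP[hy /IHs]; rewrite big_cons -mulrA; apply: roots_in_XsubC.
have sg : size (\prod_(x <- s) ('X - x%:P) * ('X - w%:P) ^+ i) = (size s + i).+1.
  rewrite size_monicM ?monic_prod_XsubC // -?size_poly_eq0 sX //.
  by rewrite size_prod_XsubC addSn addnS.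
apply: (@last_root_slide _ w) => [t ht z|].
  apply: last_root_strip; first by apply: roots_in_XsubC => //; apply: strip_seg.
  by rewrite size_XsubCM ?sg ?ltnS //; case: hg.
by rewrite mulrCA -exprS; apply: IHs => //; rewrite addnS.
Qed.

(** In degree [K] only the leading coefficient matters to [phi], so [g] may be replaced by a power
    of ['X - w%:P]. *)
Lemma phi_monic g : g \is monic -> size g = K.+1 -> phi g != 0.
Proof.
move=> gm sg; have sX : size (('X - w%:P) ^+ K) = K.+1 by rewrite size_exp_XsubC.
have Xm : ('X - w%:P) ^+ K \is monic by rewrite monic_exp ?monicXsubC.
have -> : phi g = phi (('X - w%:P) ^+ K).
  apply/eqP; rewrite -subr_eq0 -linearB /=; apply/eqP/phi_low/leq_sizeP => j.
  rewrite coefB leq_eqVlt => /orP[/eqP <-|Kj]; last by rewrite !nth_default ?sg ?sX ?subr0.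
  by move/monicP: gm; move/monicP: Xm; rewrite /lead_coef sg sX => -> ->; rewrite subrr.
apply: phi_strip; last by rewrite sX !ltnS leqnn ltnW.
exact: roots_in_exp.
Qed.

(** Induction on the roots [u] allowed to leave the strip, for all [s]: the step uses the hypothesis
    with a further root added to [s]. *)
Lemma last_root_half u s :
  all (fun x => height a x < c) u -> all (strip a e c) s ->
  (K <= size u + size s <= n)%N ->
  phi (\prod_(x <- u) ('X - x%:P) * \prod_(x <- s) ('X - x%:P)) != 0 /\
  ((size u + size s < n)%N ->
   c <= height a
     (last_root (\prod_(x <- u) ('X - x%:P) * \prod_(x <- s) ('X - x%:P)))).
Proof.
elim: u s => [|x u IHu] s /=.
  move=> _ hs /andP[Ks sn]; rewrite big_nil mul1r; split=> [|sn'].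
    by apply: phi_strip; [exact: prod_roots_in | rewrite size_prod_XsubC !ltnS Ks].
  by have := @last_root_base s 0 hs; rewrite mulr1 addn0; apply; rewrite Ks.
move=> /andP[hx hu] hs; rewrite addSn => /andP[Ks sn].
have ne0 y : height a y < c ->
    phi (\prod_(x <- y :: u) ('X - x%:P) * \prod_(x <- s) ('X - x%:P)) != 0.
  move=> hy; rewrite big_cons -mulrA; set g := _ * \prod_(x <- s) _.
  (* In total degree [K] the cofactor [g] is too short for the induction hypothesis. Above it, the
     last root of [g] has height at least [c] and thus differs from [y]. *)
  move: Ks; rewrite leq_eqVlt => /orP[/eqP EK|Ks].
    apply: phi_monic; first by rewrite !monicMl ?monicXsubC ?monic_prod_XsubC.
    by rewrite /g -big_cat size_XsubCM ?monic_neq0 ?monic_prod_XsubC //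
      size_prod_XsubC size_cat -addSn EK.
  have [|g0 hg] := IHu s hu hs; first by rewrite -ltnS Ks ltnW.
  rewrite phi_XsubC_root // mulf_neq0 // subr_eq0.
  by apply: contraTneq (hg sn) => ->; rewrite -ltNge.
split=> [|sn']; first exact: ne0.
rewrite big_cons -mulrA; apply: (@last_root_slide _ w) => [t ht z|].
  have hz : height a z < c.
    by apply: height_seg_lt => //; case/andP: hw.
  have := ne0 z hz; rewrite big_cons -mulrA => z0; split=> //.
  (* If [r] were in the strip, [phi] would kill the product with both [r] and [z] as roots, making
     [z] the last root of [h], which has [r] in place of [z]. With [r] added to [s], the induction
     hypothesis puts that last root at height at least [c], above [z]. *)
  set r := last_root _; apply/negP => hr.
  have [||_ H] := IHu (r :: s) hu; first by rewrite /= hr.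
    by rewrite /= addnS Ks.
  have [||r0 _] := IHu (r :: s) hu; first by rewrite /= hr.
    by rewrite /= addnS Ks.
  move: H r0; rewrite /= addnS => /(_ sn'); set h := _ * _ => H r0.
  have := phi_XsubC_root z r0; have -> : ('X - z%:P) * h =
      ('X - r%:P) * (('X - z%:P) *
        (\prod_(x <- u) ('X - x%:P) * \prod_(x <- s) ('X - x%:P))).
    by rewrite /h big_cons; ring.
  rewrite phi_XsubC_root // subrr mulr0 => /esym/eqP.
  rewrite mulf_eq0 (negPf r0) subr_eq0 /= => /eqP hzr.
  by move: H; rewrite hzr leNgt hz.
have [||_] := IHu (w :: s) hu; first by rewrite /= hw.
  by rewrite /= addnS Ks.
by rewrite big_cons mulrCA /= addnS; apply.
Qed.

Lemma phi_half g : roots_in (fun x => height a x < c) g ->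
  (K < size g <= n.+1)%N -> phi g != 0.
Proof.
move=> hg; have [u [hu -> ->]] := roots_in_prod hg; rewrite !ltnS => hs.
have [||u0 _] := @last_root_half u [::] hu; rewrite ?addn0 //.
rewrite phiZ mulf_neq0 //; first by rewrite lead_coef_eq0; case: hg.
by move: u0; rewrite big_nil mulr1.
Qed.

End Functional.

(** * Operators into one half-plane *)

Section Operator.
Context {R : rcfType}.
Notation C := R[i].
(* [gam < height b z] defines one half-plane of the target: [H1] or [H2]. *)
Variables (b : C) (gam : R) (n : nat) (T : {linear {poly C} -> {poly C}}).
Implicit Types (a x y z w : C) (c e t : R) (f g h : {poly C}) (s u : seq C).

Hypothesis b0 : b != 0.

Definition zero_or_stable f := f = 0 \/ forall z, gam < height b z -> f.[z] != 0.

Definition eval_at z : {scalar {poly C}} := horner_eval z \o T.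

Lemma eval_atE z f : eval_at z f = (T f).[z].
Proof. by []. Qed.

Lemma stable_eval f z : zero_or_stable f -> gam < height b z -> f.[z] = 0 -> f = 0.
Proof. by case=> // h /h /negP + f0; case; apply/eqP. Qed.

(** Here the polynomial is fixed and the evaluation point moves along a segment in the target
    half-plane. *)
Lemma last_root_path a c e w K z0 z1 : e < c -> strip a e c w -> (K < n)%N ->
  (forall g, roots_in (strip a e c) g -> (K < size g <= n.+1)%N ->
     forall z, gam < height b z -> (T g).[z] != 0) ->
  gam < height b z0 -> gam < height b z1 ->
  c <= height a (last_root (eval_at z0) (('X - w%:P) ^+ K)) ->
  c <= height a (last_root (eval_at z1) (('X - w%:P) ^+ K)).
Proof.
move=> ec hw Kn alive h0 h1; pose g := ('X - w%:P) ^+ K.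
pose path p := p \Po (z0%:P + (z1 - z0)%:P * 'X) : {poly C}.
have pathE p t : (path p).[t%:C] = p.[z0 + t%:C * (z1 - z0)].
  by rewrite /path horner_comp !hornerE [_ * t%:C]mulrC.
have path0 p : (path p).[0] = p.[z0].
  by rewrite -[0](rmorph0 (real_complex R)) pathE rmorph0 mul0r addr0.
have path1 p : (path p).[1] = p.[z1].
  by rewrite -[1](rmorph1 (real_complex R)) pathE rmorph1 mul1r addrC subrK.
have := @strip_ivt _ a e c (path (T ('X * g))) (path (T g)) ec.
rewrite !path0 !path1; apply=> t ht; rewrite !pathE.
set z := z0 + _; have hz : gam < height b z.
  by rewrite -ltrN2 -heightNl height_seg_lt // heightNl ltrN2.
apply: (@last_root_strip _ a c e K n (eval_at z)) => [g' hg hs||].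
- exact: alive.
- exact: roots_in_exp.
- by rewrite size_exp_XsubC leqnn.
Qed.

Lemma half_closure a c e w K z0 : a != 0 -> e < c -> strip a e c w -> (K < n)%N ->
  (forall h, (size h <= K)%N -> T h = 0) ->
  (forall g, roots_in (strip a e c) g -> (K < size g <= n.+1)%N ->
     forall z, gam < height b z -> (T g).[z] != 0) ->
  gam < height b z0 -> c <= height a (last_root (eval_at z0) (('X - w%:P) ^+ K)) ->
  forall f, roots_in (fun x => height a x <= c) f -> (size f <= n.+1)%N ->
  zero_or_stable (T f).
Proof.
move=> a0 ec hw Kn low alive hz0 start.
have open_half f z : roots_in (fun x => height a x < c) f ->
    (size f <= n.+1)%N -> gam < height b z -> T f = 0 \/ (T f).[z] != 0.
  move=> hf sf hz; have [/low->|Kf] := leqP (size f) K; [by left | right].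
  apply: (@phi_half _ a w c e K n (eval_at z)) hf _; rewrite ?Kf //.
  - by move=> h /low Th; rewrite eval_atE Th horner0.
  - by move=> g hg hs; apply: alive.
  - exact: (last_root_path ec hw Kn alive hz0 hz start).
have closed u s : all (fun x => height a x <= c) u ->
    all (fun x => height a x < c) s -> (size u + size s <= n)%N ->
    zero_or_stable (T (\prod_(x <- u) ('X - x%:P) * \prod_(x <- s) ('X - x%:P))).
  elim: u s => [|x u IHu] s /=.
    move=> _ hs sn; rewrite big_nil mul1r.
    set f := \prod_(x <- s) _; have [->|Tf0] := eqVneq (T f) 0; first by left.
    right=> z hz; case: (@open_half f z) => //; first exact: prod_roots_in.
      by rewrite size_prod_XsubC.
    by move=> H; rewrite H eqxx in Tf0.
  move=> /andP[hx hu] hs sn; rewrite big_cons -mulrA; set f := _ * \prod_(x <- s) _.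
  (* Pushing the root [x] inwards to [x - t a] adds [t a f] to the polynomial, which is a pencil in
     [t]. *)
  apply: (@pencil_stable _ b gam _ (T (a *: f))) => t /andP[t0 _].
  have hs' : all (fun x => height a x < c) (x - t%:C * a :: s).
    by rewrite /= hs andbT heightB heightZ ltrBlDr (le_lt_trans hx) // ltrDl
      mulr_gt0 ?height_gt0.
  have := IHu _ hu hs'; rewrite big_cons mulrCA -/f /= addnS -addSn => /(_ sn).
  have -> : ('X - (x - t%:C * a)%:P) * f = ('X - x%:P) * f + t%:C *: (a *: f).
    by rewrite -!mul_polyC; ring.
  by rewrite linearD [T (t%:C *: _)]linearZ.
move=> f hf; have [u [hu -> ->]] := roots_in_prod hf => sf.
have := closed u [::] hu isT; rewrite addn0 big_nil mulr1 => /(_ sf).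
have k0 : lead_coef f != 0 by rewrite lead_coef_eq0; case: hf.
rewrite linearZ /=; case=> [->|H]; [left | right]; first by rewrite scaler0.
by move=> z hz; rewrite hornerZ mulf_neq0 // H.
Qed.

Variables (a : C) (c e : R).
Hypothesis a0 : a != 0.
Hypothesis ec : e < c.
Hypothesis pres : forall f, roots_in (fun x => e <= height a x <= c) f ->
  (size f <= n.+1)%N -> zero_or_stable (T f).

Definition rank_le1 := exists q, forall f, (size f <= n.+1)%N -> exists k, T f = k *: q.

Lemma pres_strip f : roots_in (strip a e c) f -> (size f <= n.+1)%N -> zero_or_stable (T f).
Proof.
case=> f0 hf; apply: pres; split=> // z /hf /andP[ez zc].
by rewrite !ltW.
Qed.

(** For small nonzero [k], [g + k *: h] is still a strip polynomial, and its image is [k *: T h]; so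
    [T h] is zero or stable. *)
Lemma eval_eq0_of_killed g h z : roots_in (strip a e c) g -> (size g <= n.+1)%N ->
  T g = 0 -> (size h <= size g)%N -> gam < height b z -> (T h).[z] = 0 -> T h = 0.
Proof.
move=> hg sg Tg sh hz hhz; have [d d0 hd] := roots_in_strip_perturb hg sh.
have d2 : 0 < d / 2 by rewrite divr_gt0.
have [|sgh rgh] := hd (d / 2).
  by rewrite ger0_norm ?ltW // ltr_pdivrMr // mulr_natr mulr2n ltrDl.
have := pres_strip rgh; rewrite sgh linearD linearZ /= Tg add0r => /(_ sg) H.
have := stable_eval H hz; rewrite hornerZ hhz mulr0 => /(_ erefl) /eqP.
by rewrite scaler_eq0 gt_eqF //= => /eqP.
Qed.

Lemma small_quotient (q m v d : C) : v != 0 -> 0 < d ->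
  exists t, t%:C * v + m != 0 /\ `|q / (t%:C * v + m)| < d.
Proof.
(* This [y] makes the denominator at least [|q| / d + 1] in modulus. *)
rewrite -normr_gt0 => v0 d0; pose y := (`|m| + `|q| / d + 1) / `|v|.
have y0 : 0 <= y by rewrite divr_ge0 // !addr_ge0 // divr_ge0 // ltW.
exists (complex.Re y); rewrite RRe_real ?ger0_real //; set D := _ + m.
have hD : `|q| / d + 1 <= `|D|.
  have : `|y * v| <= `|D| + `|m| by rewrite -[y * v](addrK m) ler_normB.
  by rewrite normrM (ger0_norm y0) /y divfK ?gt_eqF // -addrA addrC lerD2r.
have D0 : 0 < `|D| by apply: lt_le_trans hD; rewrite ltr_wpDl // divr_ge0 // ltW.
split; first by rewrite -normr_gt0.
rewrite normrM normfV ltr_pdivrMr // mulrC -ltr_pdivrMr //.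
by apply: lt_le_trans hD; rewrite ltrDl.
Qed.

(* Writing [phi] for the evaluation of [T] at a point of the half-plane, [phi] kills
   [('X - x%:P) * (g + k *: h)] when [k = phi ('X * g) / (x * phi h - phi ('X * h))],
   and [k] is small if [x] is a large point of the strip. *)
Lemma killed_step g h : roots_in (strip a e c) g -> (size g <= n)%N ->
  T g = 0 -> (size h <= size g)%N -> T h != 0 ->
  exists g', [/\ roots_in (strip a e c) g', size g' = (size g).+1 & T g' = 0].
Proof.
move=> hg sg Tg sh Th.
have [z hz] : exists z, gam < height b z.
  by have [z hz] := height_surj (gam + 1) b0; exists z; rewrite hz ltrDl.
have [w hw] := strip_nonempty a0 ec.
have [d d0 hd] := roots_in_strip_perturb hg sh.
have [phi phiE] : exists phi : {scalar {poly C}}, forall f, phi f = (T f).[z].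
  by exists (eval_at z).
have ph : phi h != 0.
  by apply: contraNneq Th; rewrite phiE => /(eval_eq0_of_killed hg (leqW sg) Tg sh hz) ->.
have pg : phi g = 0 by rewrite phiE Tg horner0.
have ia0 : 'i%C * a != 0.
  by rewrite mulf_neq0 // eq_complex /= oner_eq0 andbF.
have v0 : 'i%C * a * phi h != 0 by rewrite mulf_neq0.
have [y [D0 kd]] := small_quotient (phi ('X * g)) (w * phi h - phi ('X * h)) v0 d0.
pose x : C := w + y%:C * ('i%C * a).
have hx : strip a e c x by rewrite /strip heightD heightZ height_rot mulr0 addr0.
have DE : y%:C * ('i%C * a * phi h) + (w * phi h - phi ('X * h))
    = x * phi h - phi ('X * h) by rewrite /x; ring.
rewrite DE in D0 kd; set k := _ / _ in kd.
have [sk rk] := hd k kd.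
exists (('X - x%:P) * (g + k *: h)); split.
- exact: roots_in_XsubC.
- by rewrite size_XsubCM ?sk //; case: rk.
apply: (@stable_eval _ z) => //.
  apply: pres_strip; first exact: roots_in_XsubC.
  by rewrite size_XsubCM ?sk //; case: rk.
rewrite -phiE.
have -> : ('X - x%:P) * (g + k *: h) = 'X * g + k *: ('X * h) - x *: g - (x * k) *: h.
  by rewrite -!mul_polyC; ring.
by rewrite !linearB linearD /= !phiZ pg /k; field.
Qed.

Lemma killed_top g h : roots_in (strip a e c) g -> (size g <= n.+1)%N ->
  T g = 0 -> (size h <= size g)%N -> T h != 0 ->
  exists g', [/\ roots_in (strip a e c) g', size g' = n.+1 & T g' = 0].
Proof.
move: {2}(n.+1 - size g)%N (erefl (n.+1 - size g)%N) => m.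
elim: m g => [|m IHm] g hm hg sg Tg sh Th.
  by exists g; split=> //; apply/eqP; rewrite eqn_leq sg -subn_eq0 hm.
have sgn : (size g <= n)%N by rewrite -ltnS -subn_gt0 hm.
have [g' [rg' sg' Tg']] := killed_step hg sgn Tg sh Th.
apply: (IHm g') => //; rewrite sg' ?(leqW sh) //.
by rewrite subSS; move: hm; rewrite subSn // => -[].
Qed.

(** A killed strip polynomial of full degree [n] may be perturbed by any polynomial of degree at
    most [n]. An image vanishing at [z] is then zero, so values at [z] determine images and the rank
    is at most one. *)
Lemma killed_low g h : ~ rank_le1 -> roots_in (strip a e c) g ->
  (size g <= n.+1)%N -> T g = 0 -> (size h <= size g)%N -> T h = 0.
Proof.
move=> rk hg sg Tg sh; apply/eqP/negPn/negP => Th; apply: rk.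
have [g' [rg' sg' Tg']] := killed_top hg sg Tg sh Th.
have [z hz] : exists z, gam < height b z.
  by have [z hz] := height_surj (gam + 1) b0; exists z; rewrite hz ltrDl.
have inj f : (size f <= n.+1)%N -> (T f).[z] = 0 -> T f = 0.
  by move=> sf; apply: (eval_eq0_of_killed rg' _ Tg' _ hz); rewrite sg'.
have hz0 : (T h).[z] != 0.
  by apply: contraNneq Th => /inj -> //; apply: leq_trans sg.
exists (T h) => f sf; exists ((T f).[z] / (T h).[z]); apply/eqP.
rewrite -subr_eq0 -linearZ -linearB /=; apply/eqP/inj.
  rewrite (leq_trans (size_polyD _ _)) // geq_max sf size_polyN.
  by rewrite (leq_trans (size_scale_leq _ _)) // (leq_trans sh).
by rewrite linearB linearZ /= hornerD hornerN hornerZ divfK ?subrr.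
Qed.

Lemma classification : rank_le1 \/
  (forall f, roots_in (fun x => height a x <= c) f -> (size f <= n.+1)%N ->
     zero_or_stable (T f)) \/
  (forall f, roots_in (fun x => e <= height a x) f -> (size f <= n.+1)%N ->
     zero_or_stable (T f)).
Proof.
case: (pselect rank_le1) => [|rk]; [by left | right].
have TX f : T f = \sum_(i < size f) f`_i *: T 'X^i.
  rewrite -{1}[f]coefK poly_def linear_sum; apply: eq_bigr => i _; exact: linearZ.
have [K0 hK0] : exists K, (T 'X^K != 0) && (K <= n)%N.
  apply: contrapT => /forallNP h; apply: rk; exists 0 => f sf; exists 0.
  rewrite scaler0 TX big1 // => i _; have := h i.
  rewrite -ltnS (leq_trans (ltn_ord i) sf) andbT => /negP/negPn/eqP ->.
  by rewrite scaler0.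
(* [K] is the least degree of a monomial that [T] does not kill. *)
have := @ex_minnP (fun K => (T 'X^K != 0) && (K <= n)%N) (ex_intro _ K0 hK0).
case=> K /andP[TK Kn'] Kmin {K0 hK0}.
have TKi i : (i < K)%N -> T 'X^i = 0.
  move=> iK; apply/eqP/negPn/negP => Ti; have := Kmin i.
  by rewrite Ti (leq_trans (ltnW iK) Kn') => /(_ isT); rewrite leqNgt iK.
have low h : (size h <= K)%N -> T h = 0.
  by move=> sh; rewrite TX big1 // => i _; rewrite TKi ?scaler0 // (leq_trans _ sh).
have Kn : (K < n)%N.
  (* If [K = n], the image depends only on the coefficient of degree [n], and the rank is at most
     one. *)
  rewrite ltn_neqAle Kn' andbT; apply/eqP => EK; apply: rk; exists (T 'X^n) => f sf.
  exists f`_n; rewrite -[LHS]subr0 -(low (f - f`_n *: 'X^n)); last first.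
    apply/leq_sizeP => j; rewrite EK coefB coefZ coefXn leq_eqVlt => /orP[/eqP <-|nj].
      by rewrite eqxx mulr1 subrr.
    by rewrite gtn_eqF // mulr0 subr0 nth_default // (leq_trans sf).
  by rewrite linearB linearZ /= opprB addrC subrK.
have alive g : roots_in (strip a e c) g -> (K < size g <= n.+1)%N ->
    forall z, gam < height b z -> (T g).[z] != 0.
  move=> rg /andP[Kg gn] z hz; apply/eqP => Tgz; move/negP: TK; apply; apply/eqP.
  apply: (killed_low rk rg gn); last by rewrite size_polyXn.
  exact: stable_eval (pres_strip rg gn) hz Tgz.
have [z hz] : exists z, gam < height b z.
  by have [z hz] := height_surj (gam + 1) b0; exists z; rewrite hz ltrDl.
have [w hw] := strip_nonempty a0 ec.
have [|||_] := @last_root_strip _ a c e K n (eval_at z) _ (('X - w%:P) ^+ K).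
- by move=> g rg sg; apply: alive.
- exact: roots_in_exp.
- by rewrite size_exp_XsubC leqnn.
rewrite /strip negb_and -!leNgt => /orP[he|hc]; [right | left]; last first.
  exact: (half_closure a0 ec hw Kn low alive hz hc).
(* Replacing [a] by [- a] turns the strip between [e] and [c] into the one between [- c] and [- e]
   and exchanges the two sides. *)
move=> f [f0 rf]; apply: (@half_closure (- a) (- e) (- c) w K z) => //.
- by rewrite oppr_eq0.
- by rewrite ltrN2.
- by rewrite strip_neg.
- move=> g [g0 rg]; apply: alive; split=> // x /rg; by rewrite strip_neg.
- by rewrite heightNl lerN2.
- by split=> // x /rf; rewrite heightNl lerN2.
Qed.

End Operator.

(** * Assembling the two half-planes *)

Section Geometry.
Context {R : realType}.
Implicit Types (a b z : R[i]) (c d e t : R) (H S : set R[i]).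

Lemma half_planeE a c z : half_plane a c z = (c < height a z).
Proof. by []. Qed.

(** A strip contains whole lines in direction ['i * b], and a half-plane whole rays in direction
    [- a]. If they coincided, [a] would be orthogonal both to ['i * b] and to [b], hence zero. *)
Lemma half_plane_not_strip a c : a != 0 ->
  ~ closed_strip [set z | height a z <= c].
Proof.
move=> a0 [b [d [e [b0 de E]]]].
have SE z : (height a z <= c) = (d <= height b z <= e).
  by apply/idP/idP => h; [move: (E) | move: (esym E)] => /(congr1 (@^~ z)) /= <-.
have [p hp] := height_surj c a0.
have SI t : height a (p + t%:C * ('i%C * b)) <= c.
  by rewrite SE heightD heightZ height_rot mulr0 addr0 -SE hp.
have ab : height a ('i%C * b) = 0.
  have := SI 1; have := SI (-1); rewrite !heightD !heightZ hp; lra.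
have SN t : 0 <= t -> d <= height b (p - t%:C * a) <= e.
  by move=> t0; rewrite -SE heightB heightZ hp lerBlDr lerDl mulr_ge0 // ltW ?height_gt0.
have ba : height b a = 0.
  apply/eqP/negPn/negP => k0; have /andP[p1 p2] := SN _ (lexx 0).
  have ed : 0 <= (e - d + 1) / `|height b a| by rewrite divr_ge0 //; lra.
  have := SN _ ed; move: p1 p2; rewrite !heightB !heightZ mul0r subr0.
  have [k|k|k] := ltrgtP (height b a) 0; last by rewrite k eqxx in k0.
    by rewrite ltr0_norm // invrN mulrN mulNr divfK // => ? ? /andP[]; lra.
  by rewrite gtr0_norm // divfK // => ? ? /andP[]; lra.
have: `|height a a * height b b| = 0.
  have -> : height a a * height b b = height b a ^+ 2 + height a ('i%C * b) ^+ 2.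
    by clear; case: a b => [? ?] [? ?]; rewrite /height /=; ring.
  by rewrite ab ba expr0n addr0 normr0.
by move/normr0_eq0/eqP; rewrite mulf_eq0 !gt_eqF ?height_gt0.
Qed.

Lemma interior_strip_lt a c e : a != 0 ->
  nonempty_interior [set z | e <= height a z <= c] -> e < c.
Proof.
move=> a0 [z] /nbhs_ballP[r /= r0 hr]; rewrite ltNge; apply/negP => ce.
have /andP[ez zc] := hr z (ballxx _ r0).
(* The step [t a] has length [r / 2], so it stays in the ball, yet strictly raises the height. *)
have r2 : 0 < complex.Re (r / 2 / `|a|).
  have : 0 < r / 2 / `|a| by rewrite !divr_gt0 ?normr_gt0.
  by rewrite ltcE /= => /andP[].
set t := complex.Re _ in r2.
have tE : t%:C = r / 2 / `|a|.
  by rewrite /t RRe_real // ger0_real // !divr_ge0 // ltW.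
have := hr (z + t%:C * a).
rewrite /ball /= opprD addNKr normrN normrM tE.
rewrite ger0_norm ?divr_ge0 // ?(ltW r0) //.
rewrite divfK ?normr_eq0 // ltr_pdivrMr // mulr_natr mulr2n ltrDl => /(_ r0).
rewrite -tE /= heightD heightZ => /andP[_].
by have := mulr_gt0 r2 (height_gt0 a0); lra.
Qed.

(** The sign of the ratio [t] of the normals decides: for positive [t] the half-planes are nested
    and the complement is a closed half-plane, not a strip. *)
Lemma complementary_half_planes H1 H2 :
  parallel_half_planes H1 H2 -> closed_strip (~` (H1 `|` H2)) ->
  nonempty_interior (~` (H1 `|` H2)) ->
  exists a c e, [/\ a != 0, e < c, H1 = [set z | c < height a z] &
    H2 = [set z | height a z < e]].
Proof.
case=> a [c [b [d [a0 b0 [t bt] -> ->]]]] hS hI.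
have t0 : t != 0 by apply: contraNneq b0 => t0; rewrite bt t0 rmorph0 mul0r.
move: hS hI; have [tn|tp|/eqP] := ltrgtP t 0; last by rewrite (negPf t0).
  have E2 : half_plane b d = [set z | height a z < d / t].
    apply/seteqP; split=> z /=; rewrite half_planeE bt heightZl;
      by rewrite ltr_ndivlMr // mulrC.
  have -> : ~` (half_plane a c `|` half_plane b d) = [set z | d / t <= height a z <= c].
    rewrite E2; apply/seteqP; split=> z /=; rewrite half_planeE.
      by move=> /not_orP[/negP + /negP]; rewrite -!leNgt => -> ->.
    by move=> /andP[h1 h2] []; apply/negP; rewrite -leNgt.
  move=> _ /(interior_strip_lt a0) ec.
  by exists a, c, (d / t); split.
have -> : ~` (half_plane a c `|` half_plane b d) = [set z | height a z <= Num.min c (d / t)].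
  apply/seteqP; split=> z /=; rewrite !half_planeE bt heightZl le_min ler_pdivlMr // mulrC.
    by move=> /not_orP[/negP + /negP]; rewrite -!leNgt => -> ->.
  by move=> /andP[h1 h2] []; apply/negP; rewrite -leNgt.
by move=> /(half_plane_not_strip a0).
Qed.

End Geometry.

(** * Extension of the operator to all polynomials *)

Section Extension.
Context {R : realType} {n : nat}.
Notation C := R[i].

Implicit Type T : {linear {poly_n.+1 C} -> {poly C}}.

(** [npolyp] truncates, so this is a linear operator on all of [{poly C}], and products such as
    ['X * g] need no degree bound to be written. *)
Definition extension T (f : {poly C}) :=
  T (npolyp n.+1 f).

Lemma extension_is_linear T : linear (extension T).
Proof.
move=> k f g; rewrite /extension -linearP; congr (T _); apply/val_inj/polyP => i /=.
rewrite coef_npolyp !(coefD, coefZ) !coef_npolyp.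
by case: ifP => // _; rewrite mulr0 addr0.
Qed.

HB.instance Definition _ (T : {linear {poly_n.+1 C} -> {poly C}}) :=
  GRing.isLinear.Build C {poly C} {poly C} _
  (extension T) (extension_is_linear T).

Lemma extension_npoly T (f : {poly_n.+1 C}) : extension T f = T f.
Proof. by congr (T _); apply/val_inj; rewrite /= npolypK. Qed.

Lemma maps_stableP T (Om Om' : set C) : maps_stable T Om Om' <->
  forall f : {poly C}, (size f <= n.+1)%N -> stable Om f ->
    extension T f = 0 \/ stable Om' (extension T f).
Proof.
split=> [h f sf Of|h _ [f [sf Of] <-]].
  have [|[m _ []]|] := h (extension T f); [|by right|by left].
  by exists (npolyp n.+1 f) => //; split; rewrite npolypK.
have := h f sf Of; rewrite extension_npoly => -[->|H]; [by right | left].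
by exists (size (T f)).
Qed.

End Extension.

Lemma scalar_pack (K : comNzRingType) (V : lmodType K) (f : V -> K) :
  scalar f -> exists alpha : {scalar V}, alpha =1 f.
Proof.
by move=> hf; exists (HB.pack_for {scalar V} f (GRing.isLinear.Build K V K *%R f hf)).
Qed.

(** * The rank-one form and the classification for one target half-plane *)

Section Main.
Context {R : realType} {n : nat}.
Notation C := R[i].
Variables (H1 H2 : set C) (T : {linear {poly_n.+1 C} -> {poly C}}).
Variables (a : C) (c e : R).
Hypothesis a0 : a != 0.
Hypothesis ec : e < c.
Hypothesis H1E : H1 = [set z | c < height a z].
Hypothesis H2E : H2 = [set z | height a z < e].

(** A generator [q] of the range is stable as soon as some stable polynomial has a nonzero image.
    Powers of ['X - w%:P] are stable and span the space, so one of them serves unless [T] is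
    zero. *)
Lemma rank1_form : maps_stable T (H1 `|` H2) (H1 `|` H2) ->
  rank_le1 n (extension T) ->
  range_dim_le1 T /\
   exists (alpha : {scalar {poly_n.+1 C}}) (p : {poly C}),
     stable_polys (H1 `|` H2) p /\ forall f, T f = alpha f *: p.
Proof.
move=> /maps_stableP pres [q hq].
have hT f : exists k, T f = k *: q.
  by have [|k Tk] := hq f; [exact: size_npoly | exists k; rewrite -extension_npoly].
split; first by exists q => _ [f _ <-]; have [k ->] := hT f; exists k.
have [w /andP[ew wc]] := strip_nonempty a0 ec.
have st j : stable (H1 `|` H2) (('X - w%:P) ^+ j).
  move=> z hz; rewrite horner_exp expf_neq0 // !hornerE subr_eq0.
  apply/eqP => zw; move: hz; rewrite zw H1E H2E.
  by case=> /=; apply/negP; rewrite -leNgt ltW.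
case: (pselect (exists2 j, (j <= n)%N & extension T (('X - w%:P) ^+ j) != 0)); last first.
  move=> h0.
  have [al alE] := @scalar_pack C {poly_n.+1 C} (fun=> 0)
    (fun k x y => esym (etrans (addr0 _) (mulr0 k))).
  exists al, 1; split.
    by exists 0 => //; split=> [|z _]; rewrite ?size_poly1 ?hornerE ?oner_neq0.
  move=> f; rewrite alE scale0r -extension_npoly.
  (* The Taylor expansion of [f] at [w]. *)
  have -> : (f : {poly C}) = (f \Po ('X + w%:P)) \Po ('X - w%:P).
    by rewrite -comp_polyA comp_polyD comp_polyX comp_polyC subrK comp_polyXr.
  rewrite [X in extension T X]comp_polyE linear_sum big1 // => i _; rewrite linearZ /=.
  apply/eqP; rewrite scaler_eq0; apply/orP; right; apply/negPn/negP => hi; apply: h0.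
  exists i => //; rewrite -ltnS (leq_trans (ltn_ord i)) //.
  by rewrite size_comp_poly2 ?size_XaddC // size_npoly.
case=> j jn Tj.
have [|k Tk] := hq (('X - w%:P) ^+ j); first by rewrite size_exp_XsubC.
have q0 : q != 0 by apply: contraNneq Tj => q0; rewrite Tk q0 scaler0.
have k0 : k != 0 by apply: contraNneq Tj => k0; rewrite Tk k0 scale0r.
have lq : lead_coef q != 0 by rewrite lead_coef_eq0.
(* The multiple of [q] is read off at the leading coefficient of [q]. *)
have [al alE] := @scalar_pack C {poly_n.+1 C} (fun f => (T f)`_(size q).-1 / lead_coef q)
  (fun k x y => ltac:(by rewrite /= linearP coefD coefZ mulrDl mulrA)).
exists al, q; split; last first.
  by move=> f; rewrite alE; have [r ->] := hT f; rewrite coefZ mulfK.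
exists (size q) => //; split=> // z hz.
have [||/eqP|/(_ z hz)] := pres (('X - w%:P) ^+ j) => //.
- by rewrite size_exp_XsubC.
- by rewrite (negPf Tj).
by rewrite Tk hornerZ mulf_eq0 negb_or => /andP[].
Qed.

Lemma stable_roots_in (Om : set C) (A : pred C) (f : {poly C}) (z0 : C) :
  Om z0 -> (forall z, ~ Om z -> A z) -> stable Om f -> roots_in A f.
Proof.
move=> Oz0 hA sf; split=> [|z /rootP fz].
  by apply: contraNneq (sf _ Oz0) => ->; rewrite horner0.
by apply: hA => /sf; rewrite fz eqxx.
Qed.

Lemma half_plane_classification b gam H : b != 0 ->
  H = [set z | gam < height b z] -> H `<=` H1 `|` H2 ->
  maps_stable T (H1 `|` H2) (H1 `|` H2) ->
  rank_le1 n (extension T) \/ maps_stable T H1 H \/ maps_stable T H2 H.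
Proof.
move=> b0 HE HH /maps_stableP pres.
have [||f [f0 rf] sf|rk|[hc|he]] := @classification _ b gam n (extension T) b0 a c e;
  [done | done | | by left | right; left | right; right].
- have sO : stable (H1 `|` H2) f.
    move=> z hz; apply/negP => /rf /andP[ez zc]; move: hz; rewrite H1E H2E.
    by case=> /=; apply/negP; rewrite -leNgt.
  case: (pres f sf sO) => [Tf|H12]; [by left | right=> z hz].
  by apply/H12/HH; rewrite HE.
- have [z0 hz0] := height_surj (c + 1) a0.
  apply/maps_stableP => f sf Hf; rewrite HE; apply: hc => //.
  apply: (@stable_roots_in H1 _ _ z0) Hf; rewrite H1E /= ?hz0 ?ltrDl // => z /negP.
  by rewrite -leNgt.
- have [z0 hz0] := height_surj (e - 1) a0.
  apply/maps_stableP => f sf Hf; rewrite HE; apply: he => //.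
  apply: (@stable_roots_in H2 _ _ z0) Hf; rewrite H2E /= ?hz0 ?gtrDl ?oppr_lt0 // => z /negP.
  by rewrite -leNgt.
Qed.

End Main.

Theorem theorem1p1 (R : realType) (n : nat) (H1 H2 : set R[i])
    (H1_half : open_half_plane H1) (H2_half : open_half_plane H2)
    (H12_parallel : parallel_half_planes H1 H2)
    (H12_strip : closed_strip (~` (H1 `|` H2)))
    (H12_interior : nonempty_interior (~` (H1 `|` H2)))
    (T : {linear {poly_n.+1 R[i]} -> {poly R[i]}}) :
  maps_stable T (H1 `|` H2) (H1 `|` H2) <->
  (range_dim_le1 T /\
   exists (alpha : {scalar {poly_n.+1 R[i]}}) (p : {poly R[i]}),
     stable_polys (H1 `|` H2) p /\ forall f, T f = alpha f *: p) \/
  ((maps_stable T H1 H1 \/ maps_stable T H2 H1) /\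
   (maps_stable T H1 H2 \/ maps_stable T H2 H2)).
Proof.
have [a [c [e [a0 ec H1E H2E]]]] :=
  complementary_half_planes H12_parallel H12_strip H12_interior.
split=> [pres|[[_ [alpha [p [sp hT]]]]|[h1 h2]]].
- have [|rk|hH1] := half_plane_classification a0 ec H1E H2E a0 H1E _ pres.
  + by move=> z hz; left.
  + by left; apply: (rank1_form a0 ec H1E H2E).
  (* [H2] lies on the other side, so its normal is [- a]. *)
  have Na0 : - a != 0 by rewrite oppr_eq0.
  have H2E' : H2 = [set z | - e < height (- a) z].
    by rewrite H2E; apply/seteqP; split=> z /=; rewrite heightNl ltrN2.
  have [|rk|hH2] := half_plane_classification a0 ec H1E H2E Na0 H2E' _ pres.
  + by move=> z hz; right.
  + by left; apply: (rank1_form a0 ec H1E H2E).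
  by right.
- apply/maps_stableP => f sf _; rewrite /extension hT.
  have [->|al0] := eqVneq (alpha (npolyp n.+1 f)) 0; first by left; rewrite scale0r.
  by right=> z hz; rewrite hornerZ mulf_neq0 //; case: sp => m _ [_]; apply.
(* A polynomial stable on the union is stable on both half-planes, so whichever alternative holds in
   (a) and in (b) applies to it. *)
apply/maps_stableP => f sf Of.
have O1 : stable H1 f by move=> z hz; apply: Of; left.
have O2 : stable H2 f by move=> z hz; apply: Of; right.
have [|T0] := eqVneq (extension T f) 0; first by left.
right=> z []; [case: h1 | case: h2] => /maps_stableP/(_ f sf) h;
  [have := h O1 | have := h O2 | have := h O1 | have := h O2];
  by case=> [E|H]; [rewrite E eqxx in T0 | exact: H].
Qed.
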